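(* The convex closure of any non-trivial ball (a ball of positive radius, i.e. $\{u: d(u,x)\le\rho\}$ with $\rho\ge 1$ an integer) in a hypercube $\mathbb{H}_d$ is the whole space.
   Context: $\mathbb{H}_d$ is the hypercube: its points are the subsets of $\{1,\ldots,d\}$, with distance $d(\gamma,\gamma')=|\gamma\triangle\gamma'|$. For points $a,b$, $$\widehat{m}(a,b)=\{u: d(a,u)=\lfloor d(a,b)/2\rfloor,\ d(a,u)+d(u,b)=d(a,b)\}\cup\{u: d(a,u)=\lceil d(a,b)/2\rceil,\ d(a,u)+d(u,b)=d(a,b)\},$$ and $\widehat{m}(S,T)=\bigcup_{s\in S,t\in T}\widehat{m}(s,t)$. A set $S$ is convex if $\widehat{m}(S,S)\subseteq S$. The convex closure of a set is the smallest convex set containing it (the intersection of all convex sets containing it). *)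

(* Defs.v *)
From mathcomp Require Import all_boot.

Set Implicit Arguments.
Unset Strict Implicit.
Unset Printing Implicit Defensive.

(* The ground set {1, ..., d} is represented by 'I_d. *)
Notation hypercube d := {set 'I_d}.

Definition hdist (d : nat) (a b : hypercube d) : nat :=
  #|(a :\: b) :|: (b :\: a)|.

(* n./2 is the floor of n/2 and uphalf n is its ceiling. *)
Definition midpoints (d : nat) (a b : hypercube d) : {set hypercube d} :=
  [set u | (hdist a u == (hdist a b)./2)
           && (hdist a u + hdist u b == hdist a b)]
  :|: [set u | (hdist a u == uphalf (hdist a b))
               && (hdist a u + hdist u b == hdist a b)].

Definition set_midpoints (d : nat) (S T : {set hypercube d}) :
    {set hypercube d} :=
  \bigcup_(s in S) \bigcup_(t in T) midpoints s t.

Definition midconvex (d : nat) (S : {set hypercube d}) : bool :=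
  set_midpoints S S \subset S.

Definition convex_closure (d : nat) (S : {set hypercube d}) :
    {set hypercube d} :=
  \bigcap_(C : {set hypercube d} | midconvex C && (S \subset C)) C.

Definition hball (d : nat) (x : hypercube d) (rho : nat) :
    {set hypercube d} :=
  [set u | hdist u x <= rho].

(* Main.v *)
(* By induction on the distance to x: if u differs from x in two coordinates
   i <> j, then u is a midpoint of the two points obtained from u by flipping i,
   resp. j; these are at distance 2 and both are closer to x than u is. *)
Require Import Defs.
From mathcomp Require Import all_boot.

(** The set whose cardinality [hdist a b] is by conversion; distance computations thus reduce to
    exclusive or on membership. *)
Definition symdiff (d : nat) (a b : hypercube d) : hypercube d :=
  (a :\: b) :|: (b :\: a).

Lemma in_symdiff (d : nat) (a b : hypercube d) (k : 'I_d) :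
  (k \in symdiff d a b) = (k \in a) (+) (k \in b).
Proof. by rewrite !inE; case: (k \in a); case: (k \in b). Qed.

Definition flip (d : nat) (i : 'I_d) (u : hypercube d) : hypercube d :=
  symdiff d u [set i].

Lemma hdist_flip (d : nat) (i : 'I_d) (u : hypercube d) :
  hdist (flip d i u) u = 1.
Proof.
rewrite -(cards1 i); apply: eq_card => k.
by rewrite [LHS]in_symdiff in_symdiff addbC addKb.
Qed.

Lemma hdistC (d : nat) (a b : hypercube d) : hdist a b = hdist b a.
Proof. by rewrite /hdist setUC. Qed.

Lemma hdist_flip2 (d : nat) (i j : 'I_d) (u : hypercube d) :
  i != j -> hdist (flip d i u) (flip d j u) = 2.
Proof.
move=> ij; transitivity #|[set i; j]|; last by rewrite cards2 ij.
apply: eq_card => k; rewrite [LHS]in_symdiff !in_symdiff !inE.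
(* The two copies of [k \in u] cancel, leaving the indicators of two distinct coordinates. *)
rewrite addbACA addbb addFb.
by case: (eqVneq k i) => // ->; rewrite (negPf ij).
Qed.

(** Flipping [i] deletes exactly [i] from the symmetric difference with [x]. *)
Lemma hdist_flip_lt (d : nat) (i : 'I_d) (u x : hypercube d) :
  i \in symdiff d u x -> hdist (flip d i u) x < hdist u x.
Proof.
move=> iD; apply: proper_card.
rewrite (_ : _ :|: _ = symdiff d u x :\ i) ?properD1 //.
apply/setP => k; rewrite [LHS]in_symdiff !in_symdiff in_setD1 in_symdiff in_set1.
rewrite addbAC; case: eqVneq => [->|_]; last by rewrite addbF.
by rewrite -in_symdiff iD.
Qed.

(** The distance 2 is even, so floor and ceiling of its half are both 1, the distance from [u] to
    either flipped point. *)
Lemma midpoint_flip (d : nat) (i j : 'I_d) (u : hypercube d) :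
  i != j -> u \in midpoints (flip d i u) (flip d j u).
Proof.
by move=> ij; rewrite !inE hdist_flip2 // (hdistC d u) !hdist_flip.
Qed.

(** Radius 1 is enough: every larger ball around [x] contains this one. *)
Lemma midconvex_ball1_full (d : nat) (C : {set hypercube d}) (x u : hypercube d) :
  midconvex C -> hball x 1 \subset C -> u \in C.
Proof.
move=> /subsetP convC /subsetP ballC.
have [n] := ubnP (hdist u x); elim: n u => // n IHn u un.
(* A distance above 1 means that [symdiff d u x] has two distinct elements, the coordinates to
   flip. *)
have [u1|/card_gt1P[i [j [iD jD ij]]]] := leqP (hdist u x) 1.
  by apply: ballC; rewrite inE.
have flipC k : k \in symdiff d u x -> flip d k u \in C.
  by move=> kD; apply: IHn; exact: leq_trans (hdist_flip_lt d k u x kD) un.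
apply: convC; apply/bigcupP; exists (flip d i u); first exact: flipC.
apply/bigcupP; exists (flip d j u); first exact: flipC.
exact: midpoint_flip.
Qed.

Theorem corollary3p3 (d : nat) (x : hypercube d) (rho : nat)
    (rho_ge1 : 1 <= rho) :
  convex_closure (hball x rho) = [set: hypercube d].
Proof.
apply/setP => u; rewrite in_setT; apply/bigcapP => C /andP[convC ballC].
apply: (midconvex_ball1_full d C x) => //; apply: subset_trans ballC.
by apply/subsetP => v; rewrite !inE => /leq_trans; apply.
Qed.
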